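(* Let $G$ and $H$ be graphs. If $q(G\vee H)=2$, then $G$ and $H$ have compatible multiplicity matrices.
   Context: Graphs are finite, simple, undirected, with nonempty vertex sets. $G\vee H$ is the join (disjoint union plus all edges between $G$ and $H$). For a graph $G$ on $\{1,\dots,n\}$, $S(G)$ is the set of real symmetric $n\times n$ matrices whose off-diagonal entry $(i,j)$ is nonzero iff $\{i,j\}$ is an edge; $q(G)$ is the minimum number of distinct eigenvalues of a matrix in $S(G)$. $\mathbb{N}=\{1,2,\dots\}$, $\mathbb{N}_0=\mathbb{N}\cup\{0\}$. For $\Lambda=(\lambda_1,\dots,\lambda_r)\in\mathbb{R}^r$ and $v=(v_1,\dots,v_r)^\top\in\mathbb{N}_0^r$, $D_{\Lambda,v}=\bigoplus_{i=1}^r\lambda_i I_{v_i}$. For a connected graph $G$ with $n$ vertices, a vector $v\in\mathbb{N}_0^r$ is a multiplicity vector for $G$ if $\sum_i v_i=n$ and there exist $\lambda_1<\lambda_2<\dots<\lambda_r$ and an orthogonal $U\in\mathbb{R}^{n\times n}$ with $UD_{\Lambda,v}U^\top\in S(G)$. If $G$ has connected components $G_1,\dots,G_k$, a matrix $V\in\mathbb{N}_0^{r\times k}$ is a multiplicity matrix for $G$ if for each $i$ its $i$th column is a multiplicity vector for $G_i$. For a matrix $X$ with at least 3 rows, $\widetilde X$ denotes $X$ with its first and last rows deleted. For $r\ge 3$, matrices $V\in\mathbb{N}_0^{r\times k}$ and $W\in\mathbb{N}_0^{r\times\ell}$ are compatible if $\widetilde V\mathbf{1}_k=\widetilde W\mathbf{1}_\ell$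 and every entry of $\widetilde V^\top\widetilde W$ is positive ($\mathbf 1_m$ is the all-ones column vector). Graphs $G,H$ have compatible multiplicity matrices if there are compatible $V,W$ with $V$ a multiplicity matrix for $G$ and $W$ one for $H$. *)

(* Defs.v *)
From HB Require Import structures.
From mathcomp Require Import all_boot all_order all_algebra finmap.
From mathcomp Require Import mathcomp_extra boolp classical_sets cardinality reals.

Set Implicit Arguments.
Unset Strict Implicit.
Unset Printing Implicit Defensive.

Import Order.TTheory GRing.Theory Num.Theory.

Local Open Scope ring_scope.

(* Empty graphs are allowed here; nonemptiness is assumed where needed. *)
Record sgraph := SGraph {
  svertex :> finType;
  sedge : rel svertex;
  sedge_sym : symmetric sedge;
  sedge_irrefl : irreflexive sedge }.

Section Join.
Variables G H : sgraph.

Definition join_edge : rel (G + H)%type := fun x y =>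
  match x, y with
  | inl a, inl b => sedge a b
  | inr a, inr b => sedge a b
  | _, _ => true
  end.

Lemma join_edge_sym : symmetric join_edge.
Proof. by move=> [a|a] [b|b] //=; rewrite sedge_sym. Qed.

Lemma join_edge_irrefl : irreflexive join_edge.
Proof. by move=> [a|a] /=; rewrite sedge_irrefl. Qed.

Definition join : sgraph := SGraph join_edge_sym join_edge_irrefl.

End Join.

Section Components.
Variable G : sgraph.

Definition induced_edge (C : {set G}) : rel {x : G | x \in C} :=
  fun x y => sedge (val x) (val y).
Arguments induced_edge : clear implicits.

Lemma induced_edge_sym (C : {set G}) : symmetric (induced_edge C).
Proof. by move=> x y; exact: sedge_sym. Qed.

Lemma induced_edge_irrefl (C : {set G}) : irreflexive (induced_edge C).
Proof. by move=> x; exact: sedge_irrefl. Qed.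

Definition induced (C : {set G}) : sgraph :=
  SGraph (@induced_edge_sym C) (@induced_edge_irrefl C).

Definition component_sets : {set {set G}} :=
  equivalence_partition (connect (@sedge G)) [set: G]%SET.

Definition ncomp : nat := #|component_sets|.

Definition component (i : 'I_ncomp) : sgraph := induced (enum_val i).

End Components.

Section Spectra.
Variable R : realType.

(* The vertices of [G] are numbered by [enum_val : 'I_#|G| -> G]. *)
Definition sym_matrices (G : sgraph) : set 'M[R]_#|G| :=
  [set A | A^T = A /\ forall i j : 'I_#|G|, i != j ->
           (A i j != 0) = sedge (enum_val i) (enum_val j)]%classic.
Arguments sym_matrices : clear implicits.

Lemma finite_eigenvalues n (A : 'M[R]_n) :
  finite_set [set a | eigenvalue A a]%classic.
Proof.
apply: contrapT => /(infinite_set_fset n.+1)[X /= sX].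
have p0 : char_poly A != 0 by rewrite monic_neq0 // char_poly_monic.
have rX : all (root (char_poly A)) X.
  by apply/allP => a aX; rewrite -eigenvalue_root_char; exact: sX.
have := max_poly_roots p0 rX (fset_uniq X).
by rewrite size_char_poly ltnS leqNgt => /negP nX /nX.
Qed.

(* [fset_set] is meaningful here by [finite_eigenvalues]. *)
Definition num_eigenvalues n (A : 'M[R]_n) : nat :=
  #|` fset_set [set a | eigenvalue A a]%classic|.

Definition num_eigenvalues_attained (G : sgraph) : pred nat :=
  fun k => `[< exists2 A, sym_matrices G A & num_eigenvalues A = k >].

Lemma num_eigenvalues_attained_ex (G : sgraph) :
  exists k, num_eigenvalues_attained G k.
Proof.
pose A : 'M[R]_#|G| := \matrix_(i, j) (sedge (enum_val i) (enum_val j))%:R.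
exists (num_eigenvalues A); apply/asboolP; exists A => //; split.
  by apply/matrixP => i j; rewrite !mxE sedge_sym.
by move=> i j _; rewrite mxE pnatr_eq0 eqb0 negbK.
Qed.

Definition q (G : sgraph) : nat := ex_minn (num_eigenvalues_attained_ex G).

(* The direct sum of the [L i *: I_(v_i)]; the summands with [v_i = 0] are
   empty. *)
Definition block_diag r (L : 'I_r -> R) (v : 'cV[nat]_r) :
    'M[R]_(\sum_i v i ord0) := \mxdiag_i (L i)%:M.

(* Only applied to connected graphs, namely the components of a graph. *)
Definition multiplicity_vector (G : sgraph) r (v : 'cV[nat]_r) : Prop :=
  exists (vn : (\sum_i v i ord0)%N = #|G|) (L : 'I_r -> R) (U : 'M[R]_#|G|),
    [/\ forall i j : 'I_r, (i < j)%N -> L i < L j,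
        U *m U^T = 1%:M
      & sym_matrices G (U *m castmx (vn, vn) (block_diag L v) *m U^T)].

Definition multiplicity_matrix (G : sgraph) r (V : 'M[nat]_(r, ncomp G)) :
    Prop :=
  forall i : 'I_(ncomp G), multiplicity_vector (component i) (col i V).

End Spectra.

(* Matrices with at least three rows are typed with [r.+3] rows. *)
Definition trim_rows r k (X : 'M[nat]_(r.+3, k)) : 'M[nat]_(r.+1, k) :=
  row' ord0 (row' ord_max X).

Definition compatible r k l (V : 'M[nat]_(r.+3, k)) (W : 'M[nat]_(r.+3, l)) :
    Prop :=
  trim_rows V *m const_mx 1%N = trim_rows W *m const_mx 1%N :> 'cV[nat]_r.+1 /\
  forall i j, (0 < ((trim_rows V)^T *m trim_rows W) i j)%N.

Definition have_compatible_multiplicity_matrices (R : realType) (G H : sgraph) :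
    Prop :=
  exists (r : nat) (V : 'M[nat]_(r.+3, ncomp G)) (W : 'M[nat]_(r.+3, ncomp H)),
    [/\ multiplicity_matrix R V, multiplicity_matrix R W & compatible V W].

(* Main.v *)
(* Rescaling a matrix of S(G \/ H) with two eigenvalues gives a symmetric
   involution with diagonal blocks A in S(G), -C in S(H) and a nowhere zero
   off-diagonal block B.  Then A B = B C, B B^T = 1 - A^2, B^T B = 1 - C^2.
   Write B as a matrix M in orthonormal eigenbases of A and C whose vectors are
   each supported on one component.  An entry M s t vanishes unless the
   eigenvalues d s of A and e t of C agree, row s has square norm 1 - d_s^2 and
   column t has square norm 1 - e_t^2.  Double counting of the squares gives
   equal multiplicities in A and C for the eigenvalues in ]-1, 1[, which are
   the inner rows of the multiplicity matrices; -1 and 1 are the outer ones.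
   Each block of B between two components is nonzero, hence so is some entry of
   the corresponding block of M: the two components share an eigenvalue, which
   is in ]-1, 1[ since its row of M is nonzero. *)
Require Import Defs.
From mathcomp Require Import all_boot all_order all_fingroup all_algebra finmap.
From mathcomp Require Import boolp cardinality reals.
From mathcomp Require Import complex ring lra.

Set Implicit Arguments.
Unset Strict Implicit.
Unset Printing Implicit Defensive.

Import Order.TTheory GRing.Theory Num.Theory.

Local Open Scope ring_scope.

(** * Spectral theorem for real symmetric matrices *)

Section Spectral.
Variable R : rcfType.

Definition sqnorm n (x : 'rV[R]_n) : R := \sum_i x 0 i ^+ 2.

Lemma sqnorm_ge0 n (x : 'rV[R]_n) : 0 <= sqnorm x.
Proof. by apply: sumr_ge0 => i _; exact: sqr_ge0. Qed.

Lemma sqnorm_eq0 n (x : 'rV[R]_n) : (sqnorm x == 0) = (x == 0).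
Proof.
rewrite psumr_eq0; last by move=> i _; exact: sqr_ge0.
apply/allP/eqP => /= [x0 | -> i _]; last by rewrite mxE expr0n eqxx.
apply/rowP => i; rewrite mxE; apply/eqP.
by have := x0 i (mem_index_enum _); rewrite sqrf_eq0.
Qed.

Lemma mulmx_tr_sqnorm n (x : 'rV[R]_n) : x *m x^T = (sqnorm x)%:M.
Proof.
apply/matrixP => i j; rewrite !ord1 !mxE mulr1n.
by apply: eq_bigr => k _; rewrite mxE expr2.
Qed.

(** Over the algebraically closed field [R[i]] there is an eigenvector z = x + iy. Since [A] has
    real entries, x and y satisfy two real equations; symmetry kills the imaginary part of the
    eigenvalue, so whichever of x, y is nonzero is a real eigenvector. *)
Lemma sym_eigenvalue n (A : 'M[R]_n.+1) :
  A^T = A -> exists a, eigenvalue A a.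
Proof.
move=> symA.
have [l] := eigenvalue_closed (map_mx (real_complex R) A) (ltn0Sn n).
case/eigenvalueP => z zA z0.
pose x := map_mx (@complex.Re R) z; pose y := map_mx (@complex.Im R) z.
have ReD : {morph @complex.Re R : u v / u + v} by move=> [? ?] [? ?].
have ImD : {morph @complex.Im R : u v / u + v} by move=> [? ?] [? ?].
have xA : x *m A = complex.Re l *: x - complex.Im l *: y.
  apply/rowP => j; have /rowP/(_ j)/(congr1 (@complex.Re R)) := zA.
  rewrite !mxE (big_morph _ ReD (erefl _)).
  have -> : complex.Re (l * z 0 j) =
      complex.Re l * complex.Re (z 0 j) - complex.Im l * complex.Im (z 0 j).
    by case: l {zA} => ? ?; case: (z 0 j).
  move=> <-; apply: eq_bigr => i _; rewrite !mxE.
  by case: (z 0 i) => u v /=; rewrite mulr0 subr0.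
have yA : y *m A = complex.Im l *: x + complex.Re l *: y.
  apply/rowP => j; have /rowP/(_ j)/(congr1 (@complex.Im R)) := zA.
  rewrite !mxE (big_morph _ ImD (erefl _)).
  have -> : complex.Im (l * z 0 j) =
      complex.Im l * complex.Re (z 0 j) + complex.Re l * complex.Im (z 0 j).
    by case: l {zA xA} => ? ?; case: (z 0 j) => ? ? /=; rewrite addrC.
  move=> <-; apply: eq_bigr => i _; rewrite !mxE.
  by case: (z 0 i) => u v /=; rewrite mulr0 add0r.
have xy0 : (x != 0) || (y != 0).
  rewrite -negb_and; apply: contraNN z0 => /andP[/eqP x0 /eqP y0].
  apply/eqP/rowP => i; have /rowP/(_ i) := x0; have /rowP/(_ i) := y0.
  rewrite !mxE.
  by case: (z 0 i) => u v /= -> ->.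
(* Symmetry of A equates (x A) y^T and (y A) x^T. *)
have b0 : complex.Im l = 0.
  have E : x *m A *m y^T = (y *m A *m x^T)^T.
    by rewrite !trmx_mul trmxK symA mulmxA.
  have Eyx : y *m x^T = x *m y^T.
    rewrite -[LHS]trmxK trmx_mul trmxK.
    by apply/matrixP => i j; rewrite !ord1 mxE.
  move: E; rewrite xA yA mulmxBl mulmxDl -!scalemxAl !mulmx_tr_sqnorm Eyx.
  move/matrixP/(_ 0 0); rewrite !mxE /= !mulr1n => E.
  have /eqP : complex.Im l * (sqnorm x + sqnorm y) = 0 by lra.
  rewrite mulf_eq0 => /orP[/eqP //|].
  rewrite paddr_eq0 ?sqnorm_ge0 // !sqnorm_eq0 => xy.
  by move: xy0; rewrite -negb_and xy.
exists (complex.Re l); apply/eigenvalueP.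
case/orP: xy0 => nz; [exists x => // | exists y => //].
  by rewrite xA b0 scale0r subr0.
by rewrite yA b0 scale0r add0r.
Qed.

(* The witness is the Householder reflection exchanging v and the first basis
   vector. *)
Lemma orthogonal_first_row n (v : 'rV[R]_(1 + n)) : sqnorm v = 1 ->
  exists P : 'M[R]_(1 + n), P *m P^T = 1%:M /\ row 0 P = v.
Proof.
move=> v1; pose e : 'rV[R]_(1 + n) := delta_mx 0 0.
have [-> | ve] := eqVneq v e.
  by exists 1%:M; rewrite trmx1 mulmx1 rowE mulmx1.
pose w := v - e; have w0 : sqnorm w != 0 by rewrite sqnorm_eq0 subr_eq0.
have we : sqnorm w = 2 - 2 * v 0 0.
  rewrite /sqnorm (eq_bigr (fun i => v 0 i ^+ 2 + (1 - 2 * v 0 i) *+ (i == 0))).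
    rewrite big_split /= -/(sqnorm v) v1 (bigD1 0) //= big1 => [|i /negPf -> //].
    by rewrite mulr1n; ring.
  move=> i _; rewrite !mxE eqxx /=; case: eqP => _ /=; ring.
pose P : 'M[R]_(1 + n) := 1%:M - (2 / sqnorm w) *: (w^T *m w).
have PT : P^T = P by rewrite /P linearB linearZ /= trmx_mul trmxK trmx1.
exists P; rewrite PT; split.
  have MM : w^T *m w *m (w^T *m w) = sqnorm w *: (w^T *m w).
    by rewrite mulmxA -(mulmxA w^T) mulmx_tr_sqnorm mul_mx_scalar -scalemxAl.
  have MP : w^T *m w *m P = - (w^T *m w).
    rewrite /P mulmxBr mulmx1 -scalemxAr MM scalerA divfK // -[X in X - _]scale1r.
    by rewrite -scalerBl -scaleN1r; congr (_ *: _); ring.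
  by rewrite {1}/P mulmxBl mul1mx -scalemxAl MP scalerN opprK subrK.
rewrite rowE /P mulmxBr mulmx1 -scalemxAr mulmxA.
have -> : delta_mx 0 0 *m w^T = (v 0 0 - 1)%:M.
  apply/matrixP => i j; rewrite !ord1 -rowE !mxE eqxx /=; ring.
rewrite mul_scalar_mx scalerA -[delta_mx 0 0]/e.
have -> : 2 / sqnorm w * (v 0 0 - 1) = -1.
  apply: (mulfI w0); rewrite mulrA [sqnorm w * _]mulrC divfK // we; ring.
by rewrite scaleN1r opprK addrC subrK.
Qed.

(** Deflation: an orthogonal [P] whose first row is a unit eigenvector conjugates [A] to a direct
    sum of its eigenvalue and a smaller symmetric block [C], which the induction hypothesis
    diagonalises. *)
Theorem sym_spectral n (A : 'M[R]_n) : A^T = A ->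
  exists (U : 'M[R]_n) (d : 'rV[R]_n),
    U *m U^T = 1%:M /\ A = U^T *m diag_mx d *m U.
Proof.
elim: n A => [|n IH] A symA.
  by exists 1%:M, 0; split; apply/matrixP => - [].
have [a /eigenvalueP[v0 v0A nz]] := sym_eigenvalue symA.
have s0 : 0 < sqnorm v0 by rewrite lt_neqAle eq_sym sqnorm_eq0 nz sqnorm_ge0.
pose v : 'rV[R]_(1 + n) := (Num.sqrt (sqnorm v0))^-1 *: v0.
have vA : v *m A = a *: v by rewrite -scalemxAl v0A !scalerA mulrC.
have v1 : sqnorm v = 1.
  rewrite /sqnorm; under eq_bigr do rewrite mxE exprMn.
  by rewrite -mulr_sumr -/(sqnorm v0) exprVn sqr_sqrtr ?mulVf ?gt_eqF // ltW.
have [P [PP Pv]] := orthogonal_first_row v1.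
have P'P : P^T *m P = 1%:M by apply: mulmx1C.
have [B EB] : exists B : 'M[R]_(1 + n), B = P *m A *m P^T by eexists.
have symB : B^T = B by rewrite EB !trmx_mul trmxK symA mulmxA.
have B0 : row 0 B = a *: delta_mx 0 0.
  rewrite EB !row_mul Pv vA -scalemxAl; congr (_ *: _).
  by rewrite -Pv -row_mul PP rowE mulmx1.
pose C := drsubmx B.
have BE : B = block_mx a%:M 0 0 C.
  have B0j j : B 0 j = a *+ (j == 0).
    by have /rowP/(_ j) := B0; rewrite !mxE eqxx /= mulr_natr.
  rewrite -[LHS]submxK; congr block_mx; last first.
  (* By symmetry the first column is the first row. *)
  - apply/matrixP => i j; rewrite -symB !mxE !ord1.
    by rewrite (_ : lshift n 0 = 0); [rewrite B0j|exact: val_inj].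
  - apply/matrixP => i j; rewrite !mxE !ord1.
    by rewrite (_ : lshift n 0 = 0); [rewrite B0j|exact: val_inj].
  - apply/matrixP => i j; rewrite !mxE !ord1.
    by rewrite (_ : lshift n 0 = 0); [rewrite B0j|exact: val_inj].
have symC : C^T = C by rewrite /C trmx_drsub symB.
have [U [d [UU CE]]] := IH C symC.
pose W : 'M[R]_(1 + n) := block_mx 1%:M 0 0 U.
have WT : W^T = block_mx 1%:M 0 0 U^T.
  by rewrite /W tr_block_mx !trmx0 trmx1.
have WW : W *m W^T = 1%:M.
  rewrite WT /W mulmx_block !(mulmx0, mul0mx, mulmx1, addr0, add0r) UU.
  by rewrite -scalar_mx_block.
have WDW : W^T *m diag_mx (row_mx a%:M d) *m W = B.
  rewrite BE CE WT /W diag_mx_row !mulmx_block.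
  rewrite !(mulmx0, mul0mx, mul1mx, mulmx1, addr0, add0r).
  by congr block_mx; apply/matrixP => i j; rewrite !ord1 !mxE.
exists (W *m P), (row_mx a%:M d); split.
  by rewrite trmx_mul mulmxA -(mulmxA W) PP mulmx1.
rewrite trmx_mul -!mulmxA (mulmxA W^T) (mulmxA (W^T *m _)) WDW EB -!mulmxA.
by rewrite P'P mulmx1 mulmxA P'P mul1mx.
Qed.

End Spectral.

(** * Eigenbases adapted to a partition of the index set *)

Section FunSpectral.
Variables (R : rcfType) (T : finType).

(** Indexing the eigenvectors by the elements of [C] itself lets the bases of disjoint sets be glued
    into one family indexed by [T]. *)
Lemma sym_spectral_in (C : {set T}) (a : T -> T -> R) :
  (forall x y, a x y = a y x) -> exists (u : T -> T -> R) (d : T -> R),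
    {in C &, forall s t, \sum_(x in C) u s x * u t x = (s == t)%:R} /\
    {in C &, forall x y, a x y = \sum_(s in C) d s * u s x * u s y}.
Proof.
(* An empty [C] arises from labels that are not taken; otherwise [x0] is the default that
   [enum_rank_in] needs. *)
move=> asym; have [-> | [x0 x0C]] := set_0Vmem C.
  by exists (fun _ _ => 0), (fun=> 0); split=> x; rewrite inE.
pose A : 'M[R]_#|C| := \matrix_(i, j) a (enum_val i) (enum_val j).
have symA : A^T = A by apply/matrixP => i j; rewrite !mxE asym.
have [U [d [UU AE]]] := sym_spectral symA.
pose rk := enum_rank_in x0C.
have rkK i : rk (enum_val i) = i := enum_valK_in x0C i.
have rk_inj : {in C &, forall x y, (rk x == rk y) = (x == y)}.
  by move=> x y xC yC; apply/eqP/eqP => [|-> //]; exact: enum_rank_in_inj.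
exists (fun s x => U (rk s) (rk x)), (fun s => d 0 (rk s)); split=> x y xC yC.
- rewrite big_enum_val -rk_inj //; have /matrixP/(_ (rk x) (rk y)) := UU.
  by rewrite !mxE => <-; apply: eq_bigr => i _; rewrite mxE rkK.
- rewrite big_enum_val; have /matrixP/(_ (rk x) (rk y)) := AE.
  rewrite mxE !enum_rankK_in // => ->; rewrite mxE; apply: eq_bigr => i _.
  by rewrite rkK mul_mx_diag !mxE; congr (_ * _); rewrite mulrC.
Qed.

(** The form is a direct sum over the fibres of [c], so eigenbases of the fibres, extended by zero,
    make up an eigenbasis of the whole. *)
Lemma sym_spectral_label (K : choiceType) (c : T -> K) (a : T -> T -> R) :
  (forall x y, a x y = a y x) -> (forall x y, c x != c y -> a x y = 0) ->
  exists (u : T -> T -> R) (d : T -> R),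
  [/\ forall s x, c s != c x -> u s x = 0,
      forall s t, \sum_x u s x * u t x = (s == t)%:R
    & forall x y, a x y = \sum_s d s * u s x * u s y].
Proof.
move=> asym a0; pose C k := [set x | c x == k].
have inC x : x \in C (c x) by rewrite inE.
have /boolp.choice[g gP] k : exists p : (T -> T -> R) * (T -> R),
    {in C k &, forall s t, \sum_(x in C k) p.1 s x * p.1 t x = (s == t)%:R} /\
    {in C k &, forall x y, a x y = \sum_(s in C k) p.2 s * p.1 s x * p.1 s y}.
  by have [u [d h]] := sym_spectral_in (C k) asym; exists (u, d).
pose u s x := if c s == c x then (g (c s)).1 s x else 0.
have neqc (x y : T) : c x != c y -> (x == y) = false.
  by apply: contraNF => /eqP->.
exists u, (fun s => (g (c s)).2 s); split=> [s x /negPf cN | s t | x y].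
- by rewrite /u cN.
- have [cst | cst] := eqVneq (c s) (c t); last first.
    rewrite neqc // big1 // => x _; rewrite /u.
    case: eqP => [<-|]; last by rewrite mul0r.
    by rewrite eq_sym (negPf cst) mulr0.
  have [h _] := gP (c s); rewrite -h ?inE ?cst // [RHS]big_mkcond.
  apply: eq_bigr => x _; rewrite /u !inE cst eq_sym.
  by case: eqP; rewrite ?mul0r.
- have [cst | cst] := eqVneq (c x) (c y); last first.
    rewrite a0 // big1 // => s _; rewrite /u.
    case: eqP => [->|]; last by rewrite mulr0 mul0r.
    by rewrite (negPf cst) mulr0.
  have [_ h] := gP (c x); rewrite h ?inE ?cst // big_mkcond.
  apply: eq_bigr => s _; rewrite /u !inE cst.
  by case: eqP => [->|]; rewrite ?mulr0 ?mul0r.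
Qed.

End FunSpectral.

(** * From labelled eigenbases to multiplicity vectors *)

Lemma card_sig1 r (p : 'I_r -> nat) i :
  #|[pred k : 'I_(\sum_j p j) | tagnat.sig1 k == i]| = p i.
Proof.
rewrite -sum1_card (reindex _ (onW_bij _ (tagnat.rank_bij (p_ := p)))) /=.
rewrite (eq_bigl (fun k : {j & 'I_(p j)} => (tag k == i) && true)); last first.
  by move=> k; rewrite inE /tagnat.sig1 tagnat.rankK andbT.
have /= <- := @sig_big_dep _ _ addn _ (fun j => 'I_(p j)) (pred1 i)
  (fun=> xpredT) (fun _ _ => 1%N).
rewrite big_pred1_eq.
by rewrite sum1_card card_ord.
Qed.

Lemma block_diagE (R : realType) r (L : 'I_r -> R) (v : 'cV[nat]_r) j k :
  block_diag L v j k = L (tagnat.sig1 j) *+ (j == k).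
Proof.
have E (p q : {i & 'I_(v i ord0)}) :
    (if tag p == tag q
     then conform_mx 0 ((L (tag p))%:M : 'M_(v (tag p) ord0)) else 0)
      (tagged p) (tagged q) = L (tag p) *+ (p == q).
  case: p q => [i a] [i' b] /=; case: (eqVneq i i') => [E|NE].
    by case: _ / E in b *; rewrite /= conform_mx_id mxE eq_Tagged.
  by rewrite mxE; case: eqP => // /(congr1 tag)/eqP; rewrite /= (negPf NE).
by rewrite mxE E (can_eq tagnat.sigK).
Qed.

(** The two lists of labels contain each label equally often, hence are permutations of each other;
    such a permutation is the bijection. *)
Lemma equifibered_bij (T : finType) r n (f : T -> 'I_r) (h : 'I_n -> 'I_r) :
  n = #|T| -> (forall i, #|[pred k | h k == i]| = #|[pred x | f x == i]|) ->
  exists2 s : 'I_n -> T, bijective s & forall k, f (s k) = h k.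
Proof.
move=> nT; subst n => hf.
have cE (T' : finType) (g : T' -> 'I_r) i :
    count_mem i (map g (enum T')) = #|[pred x | g x == i]|.
  by rewrite -sum1_count big_map big_enum_cond sum1_card.
have /tuple_permP[p pE] :
    perm_eq [tuple h k | k < #|T|] (map_tuple f (enum_tuple T)).
  by apply/allP => /= i _; rewrite /= !cE hf.
exists (fun k => tnth (enum_tuple T) (p k)); last first.
  move=> k; have := congr1 (fun t : seq 'I_r => nth (h k) t k) pE.
  by rewrite -!tnth_nth !tnth_mktuple tnth_map.
apply: inj_card_bij; last by rewrite card_ord.
by move=> j k /(tuple_uniqP _ (enum_uniq _))/perm_inj.
Qed.

(** Here [f s] is the rank of the eigenvalue of the eigenvector [u s]. The definition wants equal
    eigenvalues in consecutive blocks, so the eigenvectors are reordered by a bijection matching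
    block numbers with the labels [f]. *)
Lemma multiplicity_vector_of_spectrum (R : realType) (K : sgraph) r
    (v : 'cV[nat]_r) (L : 'I_r -> R) (f : K -> 'I_r) (u : K -> K -> R) :
  (forall i j : 'I_r, (i < j)%N -> L i < L j) ->
  (forall i, v i ord0 = #|[pred s | f s == i]|) ->
  (forall x y, \sum_s u s x * u s y = (x == y)%:R) ->
  (forall x y, x != y ->
     (\sum_s L (f s) * u s x * u s y != 0) = sedge x y) ->
  multiplicity_vector R K v.
Proof.
move=> Lmono vE uu edges.
have vn : (\sum_i v i ord0)%N = #|K|.
  rewrite -sum1_card (partition_big f xpredT) //=; apply: eq_bigr => i _.
  by rewrite sum1_card vE.
have [s s_bij sE] := equifibered_bij vn
  (fun i => etrans (card_sig1 (fun j => v j ord0) i) (vE i)).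
pose U : 'M[R]_#|K| := \matrix_(i, j) u (s (cast_ord (esym vn) j)) (enum_val i).
have c_bij : bijective (cast_ord (esym vn)).
  by exists (cast_ord vn) => x; apply: val_inj.
have DE j k : castmx (vn, vn) (block_diag L v) j k
    = L (f (s (cast_ord (esym vn) j))) *+ (j == k).
  by rewrite castmxE block_diagE (inj_eq (@cast_ord_inj _ _ _)) sE.
have ME x y : (U *m castmx (vn, vn) (block_diag L v) *m U^T) x y
    = \sum_s L (f s) * u s (enum_val x) * u s (enum_val y).
  rewrite (reindex s (onW_bij _ s_bij)) (reindex _ (onW_bij _ c_bij)) mxE.
  apply: eq_bigr => j _; rewrite !mxE (bigD1 j) //=.
  rewrite [X in (_ + X) * _]big1 => [|k kj].
    by rewrite DE mxE eqxx mulr1n addr0 [_ * L _]mulrC.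
  by rewrite DE (negPf kj) mulr0.
exists vn, L, U; split => //.
  apply/matrixP => x y; rewrite mxE [RHS]mxE -(inj_eq enum_val_inj) -uu.
  rewrite (reindex s (onW_bij _ s_bij)) (reindex _ (onW_bij _ c_bij)).
  by apply: eq_bigr => j _; rewrite !mxE.
split=> [|x y xy].
  by apply/matrixP => x y; rewrite mxE !ME; apply: eq_bigr => j _;
    rewrite mulrAC.
by rewrite ME edges // (inj_eq enum_val_inj).
Qed.

Corollary sym_spectral_block (R : rcfType) n (K : choiceType) (c : 'I_n -> K)
    (A : 'M[R]_n) :
  A^T = A -> (forall x y, c x != c y -> A x y = 0) ->
  exists (U : 'M[R]_n) (d : 'rV[R]_n),
  [/\ U *m U^T = 1%:M, A = U^T *m diag_mx d *m U
    & forall s x, c s != c x -> U s x = 0].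
Proof.
move=> symA A0; have asym x y : A x y = A y x by rewrite -{1}symA mxE.
have [u [d [u0 UU AE]]] := sym_spectral_label asym A0.
exists (\matrix_(s, x) u s x), (\row_s d s); split=> [||s x]; last first.
- by rewrite mxE; apply: u0.
- apply/matrixP => x y; rewrite AE mul_mx_diag !mxE; apply: eq_bigr => s _.
  by rewrite !mxE [u s x * _]mulrC.
- apply/matrixP => s t; rewrite !mxE -UU; apply: eq_bigr => x _.
  by rewrite !mxE.
Qed.

(** * Intertwiners written in eigenbases *)

Section Intertwining.
Variables (R : rcfType) (p q : nat).
Variables (A : 'M[R]_p) (B : 'M[R]_(p, q)) (C : 'M[R]_q).
Variables (U : 'M[R]_p) (W : 'M[R]_q) (d : 'rV[R]_p) (e : 'rV[R]_q).
Hypotheses (AB : A *m B = B *m C).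
Hypothesis AA : A *m A + B *m B^T = 1%:M.
Hypotheses (UU : U *m U^T = 1%:M) (WW : W *m W^T = 1%:M).
Hypotheses (AE : A = U^T *m diag_mx d *m U) (CE : C = W^T *m diag_mx e *m W).

Variable M : 'M[R]_(p, q).
Hypothesis ME : M = U *m B *m W^T.

Let U'U : U^T *m U = 1%:M. Proof. exact: mulmx1C. Qed.
Let W'W : W^T *m W = 1%:M. Proof. exact: mulmx1C. Qed.

(** In the eigenbases [A *m B = B *m C] reads [diag_mx d *m M = M *m diag_mx e]; compare entries and
    cancel. *)
Lemma intertwiner_eigen s t : M s t != 0 -> d 0 s = e 0 t.
Proof.
move=> Mst; have UA : U *m A = diag_mx d *m U by rewrite AE !mulmxA UU mul1mx.
have CW : C *m W^T = W^T *m diag_mx e by rewrite CE -!mulmxA WW mulmx1.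
have : diag_mx d *m M = M *m diag_mx e.
  by rewrite ME !mulmxA -UA -(mulmxA U) AB -!mulmxA CW.
move/matrixP/(_ s t); rewrite mul_diag_mx mul_mx_diag !mxE mulrC.
by move/(mulfI Mst).
Qed.

Lemma intertwiner_row_norm s : \sum_t M s t ^+ 2 = 1 - d 0 s ^+ 2.
Proof.
have : M *m M^T = 1%:M - diag_mx d *m diag_mx d.
  rewrite ME !trmx_mul trmxK !mulmxA -(mulmxA (U *m B)) W'W mulmx1.
  (* [addKr] brings in [AA] by replacing B B^T with 1 - A^2. *)
  rewrite -(mulmxA U) -[B *m B^T](addKr (A *m A)) AA mulmxDr mulmxDl mulmx1 UU.
  rewrite addrC mulmxN mulNmx AE; congr (_ - _).
  rewrite !mulmxA UU mul1mx -!mulmxA UU mulmx1 (mulmxA U) UU mul1mx.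
  by [].
move/matrixP/(_ s s); rewrite mulmx_diag !mxE eqxx !mulr1n expr2 => <-.
by apply: eq_bigr => t _; rewrite !mxE expr2.
Qed.

Lemma intertwiner_mul : B = U^T *m M *m W.
Proof. by rewrite ME !mulmxA U'U mul1mx -mulmxA W'W mulmx1. Qed.

(** A nonzero entry of U^T M W has a nonzero term. When eigenvectors live on single components, this
    puts [s] and [t] in the components of [x] and [y]. *)
Lemma intertwiner_entry x y : B x y != 0 ->
  exists s t, [/\ U s x != 0, W t y != 0 & M s t != 0].
Proof.
apply: contraPP => noM; apply/negP; rewrite negbK intertwiner_mul mxE.
rewrite big1 // => t _.
rewrite mxE mulr_suml big1 // => s _; rewrite mxE; apply/eqP/negPn/negP.
rewrite !mulf_eq0 !negb_or => /andP[/andP[Us Mst] Wt].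
by apply: noM; exists s, t.
Qed.

End Intertwining.

Lemma card_common_eigenvalue (R : rcfType) p q (M : 'M[R]_(p, q))
    (d : 'rV[R]_p) (e : 'rV[R]_q) l :
  (forall s t, M s t != 0 -> d 0 s = e 0 t) ->
  (forall s, \sum_t M s t ^+ 2 = 1 - d 0 s ^+ 2) ->
  (forall t, \sum_s M s t ^+ 2 = 1 - e 0 t ^+ 2) ->
  l ^+ 2 != 1 -> #|[pred s | d 0 s == l]| = #|[pred t | e 0 t == l]|.
Proof.
move=> dMe Md Me l1; have l0 : 1 - l ^+ 2 != 0 by rewrite subr_eq0 eq_sym.
have count n (f : 'rV[R]_n) (F : 'I_n -> R) :
    (forall s, F s = 1 - f 0 s ^+ 2) ->
    \sum_(s | f 0 s == l) F s = (1 - l ^+ 2) *+ #|[pred s | f 0 s == l]|.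
  by move=> FE; rewrite -sumr_const; apply: eq_bigr => s /eqP fl; rewrite FE fl.
apply/eqP; rewrite -(eqr_nat R) -(inj_eq (mulfI l0)) !mulr_natr.
rewrite -(count _ _ _ Md) -(count _ _ _ Me) exchange_big /=.
(* Both conditions become boolean multiples, so the two sums of squares can be compared entry by
   entry: where [M s t] is nonzero the conditions agree. *)
rewrite [X in X == _](eq_bigr (fun t => \sum_s M s t ^+ 2 *+ (d 0 s == l))).
  rewrite [X in _ == X]big_mkcond; apply/eqP; apply: eq_bigr => t _.
  rewrite -[RHS]mulrb -sumrMnl; apply: eq_bigr => s _.
  have [->|/dMe -> //] := eqVneq (M s t) 0.
  by rewrite expr0n !mul0rn.
by move=> t _; rewrite big_mkcond; apply: eq_bigr => s _; rewrite mulrb.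
Qed.

(** * Connected components and their multiplicity vectors *)

Lemma component_labelling (G : sgraph) : exists c : G -> 'I_(ncomp G),
  [/\ forall x (i : 'I_(ncomp G)), (x \in (enum_val i : {set G})) = (c x == i),
      forall x y, sedge x y -> c x = c y
    & forall i, exists x, c x = i].
Proof.
have eqvE : {in [set: G]%SET & &, equivalence_rel (connect (@sedge G))}.
  have symE : connect_sym (@sedge G).
    exact/sym_connect_sym/sedge_sym.
  move=> x y z _ _ _; split; first exact: connect0.
  by move=> xy; exact: (same_connect symE xy z).
have /and3P[/eqP covP trivP P0] := equivalence_partitionP eqvE.
have /fin_all_exists[c cP] (x : G) :
    exists i : 'I_(ncomp G), x \in (enum_val i : {set G}).
  have xP : x \in cover (component_sets G) by rewrite covP inE.
  exists (enum_rank_in (pblock_mem xP) (pblock (component_sets G) x)).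
  by rewrite enum_rankK_in ?pblock_mem // mem_pblock.
have cE x (i : 'I_(ncomp G)) : (x \in (enum_val i : {set G})) = (c x == i).
  apply/idP/eqP => [xi|<- //]; apply: enum_val_inj.
  rewrite -(def_pblock trivP (enum_valP i) xi).
  by rewrite (def_pblock trivP (enum_valP (c x)) (cP x)).
exists c; split => // [x y xy|i].
  apply/esym/eqP; rewrite -cE -(def_pblock trivP (enum_valP (c x)) (cP x)).
  by rewrite (pblock_equivalence_partition eqvE) ?inE ?connect1.
have /set0Pn[x xi] : (enum_val i : {set G}) != finset.set0.
  by apply: contraNneq P0 => <-; exact: enum_valP.
by exists x; apply/eqP; rewrite -cE.
Qed.

(** Passes from the subtype of vertices of a component to matrix indices. A general [op] covers both
    cardinalities and sums in [R]. *)
Lemma big_component (T : Type) (idx : T) (op : Monoid.com_law idx) (G : sgraph)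
    (c : G -> 'I_(ncomp G)) i (P : pred 'I_#|G|) (F : 'I_#|G| -> T) :
  (forall x (i : 'I_(ncomp G)), (x \in (enum_val i : {set G})) = (c x == i)) ->
  \big[op/idx]_(s : component i | P (enum_rank (val s))) F (enum_rank (val s)) =
  \big[op/idx]_(j | (c (enum_val j) == i) && P j) F j.
Proof.
move=> cE.
rewrite -(big_sub_cond (enum_val i : {set G}) (P \o enum_rank) (F \o enum_rank)).
rewrite [RHS](reindex _ (onW_bij _ (@enum_rank_bij G))) /=.
by apply: eq_bigl => x; rewrite enum_rankK cE.
Qed.

(** Eigenvectors indexed by other components vanish on this one, so summing over its own
    eigenvectors is summing over all of them; thus U^T U = 1 and A = U^T D U restrict to the
    component. *)
Lemma component_multiplicity (R : realType) (G : sgraph)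
    (c : G -> 'I_(ncomp G)) (A U : 'M[R]_#|G|) (d : 'rV[R]_#|G|)
    r (L : 'I_r -> R) (f : 'I_#|G| -> 'I_r) i (v : 'cV[nat]_r) :
  (forall x (i : 'I_(ncomp G)), (x \in (enum_val i : {set G})) = (c x == i)) ->
  (forall i j, i != j -> (A i j != 0) = sedge (enum_val i) (enum_val j)) ->
  U *m U^T = 1%:M -> A = U^T *m diag_mx d *m U ->
  (forall s x, c (enum_val s) != c (enum_val x) -> U s x = 0) ->
  (forall i j : 'I_r, (i < j)%N -> L i < L j) -> (forall s, d 0 s = L (f s)) ->
  (forall k, v k ord0 = #|[pred s | (c (enum_val s) == i) && (f s == k)]|) ->
  multiplicity_vector R (component i) v.
Proof.
move=> cE edges /mulmx1C U'U AE U0 Lmono dL vE.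
pose rk (s : component i) : 'I_#|G| := enum_rank (val s).
have rk_eq x y : (rk x == rk y) = (x == y) by rewrite (inj_eq enum_rank_inj).
have crk x : c (enum_val (rk x)) = i.
  by apply/eqP; rewrite enum_rankK -cE; exact: (valP x).
have sum_rk (F : 'I_#|G| -> R) :
    (forall j, c (enum_val j) != i -> F j = 0) -> \sum_s F (rk s) = \sum_j F j.
  move=> F0; rewrite (big_component _ _ predT F cE) big_mkcond.
  by apply: eq_bigr => j _; rewrite andbT; case: ifPn => // /F0.
apply: (@multiplicity_vector_of_spectrum _ _ _ _ L (f \o rk)
  (fun s x => U (rk s) (rk x))) => //= [k | x y | x y xy].
- rewrite vE -[LHS]sum1_card -[RHS]sum1_card.
  exact/esym/(big_component _ _ (fun s => f s == k) (fun=> 1%N) cE).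
- rewrite (sum_rk (fun s => U s (rk x) * U s (rk y))) => [|j cj]; last first.
    by rewrite U0 ?mul0r // crk.
  rewrite -rk_eq; have /matrixP/(_ (rk x) (rk y)) := U'U; rewrite !mxE => <-.
  by apply: eq_bigr => j _; rewrite mxE.
rewrite (sum_rk (fun s => L (f s) * U s (rk x) * U s (rk y))) => [|j cj]; last first.
  by rewrite U0 ?mulr0 ?mul0r // crk.
have -> : \sum_j L (f j) * U j (rk x) * U j (rk y) = A (rk x) (rk y).
  rewrite AE mul_mx_diag !mxE; apply: eq_bigr => j _.
  by rewrite !mxE -dL [d _ _ * _]mulrC.
by rewrite edges ?rk_eq // !enum_rankK.
Qed.

(** * From two eigenvalues to a symmetric involution *)

Lemma num_eigenvalues2P (R : realType) n (A : 'M[R]_n) :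
  num_eigenvalues A = 2%N ->
  exists a b, a != b /\ forall l, eigenvalue A l -> l = a \/ l = b.
Proof.
rewrite /num_eigenvalues; set X := fset_set _ => X2.
have inX l : eigenvalue A l -> l \in enum_fset X.
  move=> Al; rewrite -[is_true _]/(is_true (l \in X)) in_fset_set.
    exact/classical_sets.mem_set.
  exact: finite_eigenvalues.
have := fset_uniq X; move: X2 inX; case: (enum_fset X) => [|a [|b []]] //= _ inX.
rewrite inE andbT => ab; exists a, b; split=> // l /inX.
by rewrite !inE => /orP[] /eqP; [left|right].
Qed.

Lemma involution_of_q2 (R : realType) (G : sgraph) : q R G = 2%N ->
  exists Q : 'M[R]_#|G|, [/\ Q^T = Q, Q *m Q = 1%:M
    & forall i j, i != j -> (Q i j != 0) = sedge (enum_val i) (enum_val j)].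
Proof.
rewrite /q; case: ex_minnP => k kP _ k2; move: kP; rewrite k2 => /asboolP[A].
case=> symA edges /num_eigenvalues2P[a [b [ab Aab]]].
have [U [d [UU AE]]] := sym_spectral symA.
(* Row [i] of [U] is an eigenvector for [d 0 i], nonzero because it has norm 1. *)
have dab i : d 0 i = a \/ d 0 i = b.
  apply: Aab; apply/eigenvalueP; exists (row i U).
    rewrite -row_mul AE !mulmxA UU mul1mx.
    by apply/rowP => j; rewrite mul_diag_mx !mxE.
  apply/eqP => Ui; have /rowP/(_ i) : row i (U *m U^T) = 0.
    by rewrite row_mul Ui mul0mx.
  by rewrite UU !mxE eqxx => /eqP; rewrite oner_eq0.
have ba : b - a != 0 by rewrite subr_eq0 eq_sym.
(* The affine map x -> c x - e sends a to -1 and b to 1; as c is nonzero, it keeps the off-diagonal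
   zero pattern. *)
pose c := 2 / (b - a); pose e := (a + b) / (b - a).
pose g : 'rV[R]_#|G| := \row_i (c * d 0 i - e).
have gg i : g 0 i * g 0 i = 1.
  by rewrite mxE /c /e; case: (dab i) => ->; field.
have QE : U^T *m diag_mx g *m U = c *: A - e%:M.
  have -> : diag_mx g = c *: diag_mx d - e%:M.
    apply/matrixP => i j; rewrite !mxE.
    by case: eqP; rewrite ?mulr1n // !mulr0n mulr0 subr0.
  rewrite mulmxBr mulmxBl AE -scalemxAr -scalemxAl mul_mx_scalar -scalemxAl.
  by rewrite (mulmx1C UU) scalemx1.
exists (U^T *m diag_mx g *m U); split.
- by rewrite !trmx_mul trmxK tr_diag_mx mulmxA.
- rewrite !mulmxA -(mulmxA _ U) UU mulmx1 -(mulmxA U^T) mulmx_diag.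
  rewrite (_ : diag_mx _ = 1%:M) ?mulmx1 ?(mulmx1C UU) //.
  by apply/matrixP => i j; rewrite mxE [X in X *+ _]mxE gg mxE.
- move=> i j ij; rewrite QE !mxE (negPf ij) mulr0n subr0 mulf_eq0 negb_or edges //.
  by rewrite /c mulf_neq0 ?invr_neq0 ?pnatr_eq0.
Qed.

(** * Blocks of the involution of a join *)

Section JoinBlocks.
Variables (R : realType) (G H : sgraph).

(** The numbering of the join is not assumed to list one side first, so blocks are read off through
    the embeddings [l] and [r]. *)
Let l (x : 'I_#|G|) : 'I_#|join G H| := enum_rank (inl (enum_val x) : join G H).
Let r (y : 'I_#|H|) : 'I_#|join G H| := enum_rank (inr (enum_val y) : join G H).

Lemma sum_join (F : 'I_#|join G H| -> R) :
  \sum_k F k = \sum_x F (l x) + \sum_y F (r y).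
Proof.
rewrite (reindex _ (onW_bij _ (@enum_rank_bij (join G H)))) big_sumType /=.
rewrite (reindex _ (onW_bij _ (@enum_val_bij G))); congr (_ + _).
by rewrite (reindex _ (onW_bij _ (@enum_val_bij H))).
Qed.

(** All the relations are blocks of Q^2 = 1. Taking [C] to be minus the lower diagonal block turns
    the vanishing mixed block into [A *m B = B *m C]. *)
Lemma join_blocks : q R (join G H) = 2%N ->
  exists (A : 'M[R]_#|G|) (B : 'M[R]_(#|G|, #|H|)) (C : 'M[R]_#|H|),
  [/\ A^T = A, C^T = C, A *m B = B *m C,
      A *m A + B *m B^T = 1%:M & C *m C + B^T *m B = 1%:M]
  /\ [/\ forall i j, i != j -> (A i j != 0) = sedge (enum_val i) (enum_val j),
      forall i j, i != j -> (C i j != 0) = sedge (enum_val i) (enum_val j)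
    & forall i j, B i j != 0].
Proof.
case/involution_of_q2 => Q [symQ QQ edges].
have Qsym i j : Q i j = Q j i by rewrite -{1}symQ mxE.
have lE x x' : (l x == l x') = (x == x').
  rewrite (inj_eq enum_rank_inj) -(inj_eq enum_val_inj).
  by apply/eqP/eqP => [[]|->].
have rE y y' : (r y == r y') = (y == y').
  rewrite (inj_eq enum_rank_inj) -(inj_eq enum_val_inj).
  by apply/eqP/eqP => [[]|->].
have lrE x y : (l x == r y) = false.
  by rewrite (inj_eq enum_rank_inj); apply/eqP.
have Q2 i j : \sum_x Q i (l x) * Q (l x) j + \sum_y Q i (r y) * Q (r y) j
    = (i == j)%:R.
  rewrite -(sum_join (fun k => Q i k * Q k j)).
  by have /matrixP/(_ i j) := QQ; rewrite !mxE.
exists (\matrix_(i, j) Q (l i) (l j)), (\matrix_(i, j) Q (l i) (r j)),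
  (\matrix_(i, j) - Q (r i) (r j)); split; split.
- by apply/matrixP => i j; rewrite !mxE Qsym.
- by apply/matrixP => i j; rewrite !mxE Qsym.
- apply/matrixP => i j; rewrite !mxE.
  have /eqP := Q2 (l i) (r j); rewrite lrE addr_eq0 -sumrN => /eqP QAB.
  transitivity (\sum_x Q (l i) (l x) * Q (l x) (r j)).
    by apply: eq_bigr => x _; rewrite !mxE.
  by rewrite QAB; apply: eq_bigr => y _; rewrite !mxE mulrN.
- apply/matrixP => i j; rewrite !mxE -lE -Q2.
  congr (_ + _); apply: eq_bigr => y _; rewrite !mxE //.
  by rewrite [Q (r y) _]Qsym.
- apply/matrixP => i j; rewrite !mxE -rE -Q2 addrC.
  congr (_ + _); apply: eq_bigr => y _; rewrite !mxE ?mulrNN //.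
  by rewrite [Q (l y) (r i)]Qsym.
- by move=> i j ij; rewrite mxE edges ?lE // !enum_rankK.
- by move=> i j ij; rewrite mxE oppr_eq0 edges ?rE // !enum_rankK.
- by move=> i j; rewrite mxE edges ?lrE // !enum_rankK.
Qed.

End JoinBlocks.

(** * Common spectrum and the compatible matrices *)

Lemma sorted_spectrum (R : realDomainType) (s : seq R) :
  uniq s -> {in s, forall x, x ^+ 2 < 1} ->
  sorted <%R (-1 :: rcons (sort <=%R s) 1).
Proof.
move=> s_uniq s1 /=; rewrite rcons_path path_sortedE; last exact: lt_trans.
have inI x : x \in sort <=%R s -> -1 < x /\ x < 1.
  by rewrite mem_sort => /s1; split; nra.
rewrite sort_lt_sorted s_uniq andbT; apply/andP; split.
  by apply/allP => x /inI[].
have := mem_last (-1) (sort <=%R s); rewrite inE => /orP[/eqP->|/inI[] //].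
lra.
Qed.

(** Gives the row sums of multiplicity matrices: adding over components counts all eigenvectors of
    one eigenvalue. *)
Lemma sum_card_label (T K : finType) (g : T -> K) (P : pred T) :
  (\sum_k #|[pred x | (g x == k) && P x]| = #|P|)%N.
Proof.
rewrite -sum1_card (partition_big g xpredT) //=; apply: eq_bigr => k _.
by rewrite -sum1_card; apply: eq_bigl => x; rewrite !inE andbC.
Qed.

Theorem theorem2p5 (R : realType) (G H : sgraph)
    (G_neq0 : (0 < #|G|)%N) (H_neq0 : (0 < #|H|)%N) :
  q R (join G H) = 2%N -> have_compatible_multiplicity_matrices R G H.
Proof.
case/join_blocks => A [B [C [[symA symC AB AA CC] [edgesA edgesC Bn0]]]].
have [cG [cGE cG_edge cG_surj]] := component_labelling G.
have [cH [cHE cH_edge cH_surj]] := component_labelling H.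
have [||U [d [UU AE U0]]] := @sym_spectral_block R _ _ (cG \o enum_val) A.
- by [].
(* A nonzero off-diagonal entry is an edge, and the ends of an edge share a component. *)
- move=> x y /= cxy; apply/eqP; apply: contraNT cxy => Axy.
  have [->|xy] := eqVneq x y; first by [].
  by rewrite edgesA // in Axy; rewrite (cG_edge _ _ Axy).
have [||W [e [WW CE W0]]] := @sym_spectral_block R _ _ (cH \o enum_val) C.
- by [].
- move=> x y /= cxy; apply/eqP; apply: contraNT cxy => Cxy.
  have [->|xy] := eqVneq x y; first by [].
  by rewrite edgesC // in Cxy; rewrite (cH_edge _ _ Cxy).
have [M ME] : exists M, M = U *m B *m W^T by eexists.
have dMe := intertwiner_eigen AB UU WW AE CE ME.
have Md := intertwiner_row_norm AA UU WW AE ME.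
(* Column norms of [M] are row norms of its transpose, for the pair [C], [B^T]. *)
have Me t : \sum_s M s t ^+ 2 = 1 - e 0 t ^+ 2.
  have MT : M^T = W *m B^T *m U^T by rewrite ME !trmx_mul trmxK mulmxA.
  have BB : C *m C + B^T *m B^T^T = 1%:M by rewrite trmxK.
  rewrite -(intertwiner_row_norm BB WW UU CE MT).
  by apply: eq_bigr => s _; rewrite mxE.
have d1 s : d 0 s ^+ 2 <= 1.
  by rewrite -subr_ge0 -Md; apply: sumr_ge0 => t _; exact: sqr_ge0.
have Md1 s t : M s t != 0 -> d 0 s ^+ 2 != 1.
  apply: contra_neq => ds1; have := Md s; rewrite ds1 subrr => /eqP.
  rewrite psumr_eq0 => [/allP/(_ t (mem_index_enum _))|t' _]; last exact: sqr_ge0.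
  by rewrite /= sqrf_eq0 => /eqP.
have cardde := card_common_eigenvalue dMe Md Me.
(* The eigenvalues of [A] other than -1 and 1. By [cardde] those of [C] are the same ([S_e] below).
   In [ls] the values -1 and 1 are always added as ends, possibly with multiplicity zero. *)
pose S0 := undup [seq x <- [seq d 0 s | s <- enum 'I_#|G|] | x ^+ 2 != 1].
pose S := sort <=%R S0; pose ls := -1 :: rcons S 1.
have memS x : (x \in S) = (x ^+ 2 != 1) && [exists s, d 0 s == x].
  rewrite mem_sort mem_undup mem_filter; congr (_ && _).
  apply/mapP/existsP => [[s _ ->]|[s /eqP <-]]; first by exists s.
  by exists s; rewrite ?mem_enum.
have S_d s : d 0 s ^+ 2 != 1 -> d 0 s \in S.
  by move=> ds1; rewrite memS ds1; apply/existsP; exists s.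
have S_e t : e 0 t ^+ 2 != 1 -> e 0 t \in S.
  move=> et1; rewrite memS et1; apply/existsP.
  have /card_gt0P[s] : (0 < #|[pred s | d ord0 s == e ord0 t]|)%N.
    by rewrite cardde //; apply/card_gt0P; exists t; rewrite inE.
  by exists s.
have ls_sorted : sorted <%R ls.
  apply: sorted_spectrum; first exact: undup_uniq.
  move=> x; rewrite -(mem_sort <=%R) memS => /andP[x1 /existsP[s /eqP ds]].
  by rewrite lt_neqAle x1 -ds d1.
have ls_uniq : uniq ls by apply: lt_sorted_uniq.
have ls_mem x : (x ^+ 2 != 1 -> x \in S) -> x \in ls.
  rewrite inE mem_rcons inE orbA [(_ == -1) || _]orbC -sqrf_eq1.
  by case: eqP => //= _ ->.
(* Any entry of [B] yields a nonzero entry of [M], hence an inner eigenvalue; this ensures at least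
   three rows. *)
have [r Sr] : exists r, size S = r.+1.
  have [s [t [_ _ Mst]]] := intertwiner_entry UU WW ME
    (Bn0 (Ordinal G_neq0) (Ordinal H_neq0)).
  by have := S_d _ (Md1 _ _ Mst); case: (S) => // x S' _; exists (size S').
have ls_size : size ls = r.+3 by rewrite /= size_rcons Sr.
pose L (k : 'I_r.+3) := ls`_k.
(* On members of [ls] the index is below [r.+3], so [inord] does not fall back on its default and
   [f] inverts [L]. *)
pose f x : 'I_r.+3 := inord (index x ls).
have Lmono (k k' : 'I_r.+3) : (k < k')%N -> L k < L k'.
  by move=> kk'; rewrite /L lt_sorted_ltn_nth // inE ls_size.
have Lf x : x \in ls -> L (f x) = x.
  by move=> xls; rewrite /L inordK ?nth_index // -ls_size index_mem.
have fL k : f (L k) = k.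
  by apply: val_inj; rewrite /= /f /L index_uniq ?ls_size // inord_val.
have Ld s : d 0 s = L (f (d 0 s)) by rewrite Lf //; apply/ls_mem/S_d.
have Le t : e 0 t = L (f (e 0 t)) by rewrite Lf //; apply/ls_mem/S_e.
pose V : 'M[nat]_(r.+3, ncomp G) :=
  \matrix_(k, i) #|[pred s | (cG (enum_val s) == i) && (f (d 0 s) == k)]|.
pose V' : 'M[nat]_(r.+3, ncomp H) :=
  \matrix_(k, j) #|[pred t | (cH (enum_val t) == j) && (f (e 0 t) == k)]|.
(* The row of the full matrix that [trim_rows] places at [k]. The shift by one skips -1, so its
   eigenvalue is the [k]-th element of [S]. *)
pose inner (k : 'I_r.+1) : 'I_r.+3 := lift ord_max (lift ord0 k).
have innerE k : inner k = k.+1 :> nat.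
  by rewrite /inner lift_max lift0.
have L_inner k : L (inner k) = S`_k.
  by rewrite /L innerE /= nth_rcons Sr ltn_ord.
exists r, V, V'; split; [move=> i|move=> j|split].
- apply: (component_multiplicity (d := d) (f := fun s => f (d 0 s))
    cGE edgesA UU AE U0 Lmono Ld).
  by move=> k; rewrite !mxE.
- apply: (component_multiplicity (d := e) (f := fun t => f (e 0 t))
    cHE edgesC WW CE W0 Lmono Le).
  by move=> k; rewrite !mxE.
(* Both row sums are total multiplicities of one inner eigenvalue, in [A] and in [C]; [cardde]
   equates them. *)
- apply/matrixP => k z; rewrite !mxE.
  transitivity #|[pred s | f (d 0 s) == inner k]|.
    rewrite -(sum_card_label (fun s => cG (enum_val s))).
    by apply: eq_bigr => i _; rewrite !mxE mulr1.
  transitivity #|[pred t | f (e 0 t) == inner k]|; last first.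
    rewrite -(sum_card_label (fun s => cH (enum_val s))).
    by apply: eq_bigr => i _; rewrite !mxE mulr1.
  have fE x : x = L (f x) -> (f x == inner k) = (x == L (inner k)).
    by move=> xE; rewrite {2}xE (can_eq fL).
  transitivity #|[pred s | d ord0 s == L (inner k)]|.
    by apply: eq_card => s; rewrite !inE fE.
  transitivity #|[pred t | e ord0 t == L (inner k)]|; last first.
    by apply: eq_card => t; rewrite !inE fE.
  apply: cardde; rewrite L_inner.
  by have : S`_k \in S by [rewrite mem_nth // Sr]; rewrite memS => /andP[].
(* The entry of [B] at vertices of components [i] and [j] gives eigenvectors [s], [t] on these
   components with a common inner eigenvalue; its row contributes a positive product. *)
- move=> i j; have [x xi] := cG_surj i; have [y yj] := cH_surj j.
  have [s [t [Usx Wty Mst]]] := intertwiner_entry UU WW ME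
    (Bn0 (enum_rank x) (enum_rank y)).
  have si : cG (enum_val s) = i.
    by apply/eqP; apply: contraNT Usx => si; rewrite U0 //= enum_rankK xi.
  have tj : cH (enum_val t) = j.
    by apply/eqP; apply: contraNT Wty => tj; rewrite W0 //= enum_rankK yj.
  have dS : d 0 s \in S by exact/S_d/(Md1 _ t).
  have kr : (index (d ord0 s) S < r.+1)%N by rewrite -Sr index_mem.
  have fk : f (d 0 s) = inner (Ordinal kr).
    by rewrite -[RHS]fL L_inner nth_index.
  rewrite mxE (bigD1 (Ordinal kr)) //= ltn_addr // !mxE muln_gt0.
  apply/andP; split; apply/card_gt0P.
    by exists s; rewrite inE si fk !eqxx.
  by exists t; rewrite inE tj -(dMe _ _ Mst) fk !eqxx.
Qed.
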